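(* Let $C\subseteq\mathbb{R}^d$ be any Cantor set, i.e. the attractor of an iterated function system $F=(f_1,\ldots,f_J)$ of contractions of $\mathbb{R}^d$ with contraction rates $\tau_j\in(0,1)$. Let $\tau=\max_{1\leq j\leq J}\tau_j\in(0,1)$ be the maximum contraction rate of the system and denote by $diam$ the diameter $\max\{\Vert\underline{x}-\underline{y}\Vert:\underline{x},\underline{y}\in C\}$ of the compact set $C$. Let $D=-\log J/\log\tau>0$. Then the set of rational vectors in $C$ up to height $N$, $$\mathcal{S}(C,N)=\{\underline{r}/s\in C:\ (r_1,\ldots,r_d,s)=1,\ 1\leq s\leq N\},$$ has cardinality at most $J^2\,diam^{D}\,N^{2D}$.
   Context: $\mathbb{R}^d$ carries the supremum norm $\Vert\underline{z}\Vert=\max_{1\leq j\leq d}|z_j|$. A contraction is a map $f:\mathbb{R}^d\to\mathbb{R}^d$ for which there is $\tau\in(0,1)$ (a contraction rate) with $\Vert f(\underline{x})-f(\underline{y})\Vert\leq\tau\Vert\underline{x}-\underline{y}\Vert$ for all $\underline{x},\underline{y}\in\mathbb{R}^d$. An iterated function system is a finite set of contractions; its attractor is the unique nonempty compact set $C$ with $\bigcup_{1\leq j\leq J}f_j(C)=C$. In the definition of $\mathcal{S}(C,N)$, $\underline{r}=(r_1,\ldots,r_d)\in\mathbb{Z}^d$, $s$ is a positive integer, and $(r_1,\ldots,r_d,s)$ denotes the greatest common divisor.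
   Formalization: The cardinality is bounded by max(1, J^2 diam^D N^{2D}) instead of J^2 diam^D N^{2D}, since the printed bound can be below 1 while one rational vector lies in C (e.g. C=[0,1/8] from x/2 and x/2+1/16, N=1: bound 1/2, S={0}). *)

(* Defs.v *)
From HB Require Import structures.
From mathcomp Require Import all_boot all_order all_algebra.
From mathcomp Require Import all_classical all_reals all_analysis.
Set Implicit Arguments.
Unset Strict Implicit.
Unset Printing Implicit Defensive.
Import Order.TTheory GRing.Theory Num.Theory.
Import numFieldNormedType.Exports.

Local Open Scope classical_set_scope.
Local Open Scope ring_scope.

(* The norm of the normed module 'rV[R]_d is the supremum norm (mx_normrE). *)

Definition contraction_rate (R : realType) (d : nat)
    (f : 'rV[R]_d -> 'rV[R]_d) (tau : R) : Prop :=
  [/\ 0 < tau, tau < 1 & tau.-lipschitz f].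

(* The equation and non-emptiness together force 0 < J. *)
Definition is_attractor (R : realType) (d J : nat)
    (F : 'I_J -> 'rV[R]_d -> 'rV[R]_d) (C : set 'rV[R]_d) : Prop :=
  [/\ C !=set0, compact C & \bigcup_(j in [set: 'I_J]) (F j @` C) = C].

(* For 0 < J and positive rates, the default value 0 plays no role. *)
Definition max_rate (R : realType) (J : nat) (tau : 'I_J -> R) : R :=
  \big[Num.max/0]_(j < J) tau j.

(* The supremum is a maximum when C is compact and nonempty. *)
Definition diam (R : realType) (d : nat) (C : set 'rV[R]_d) : R :=
  sup [set r | exists x y, [/\ C x, C y & r = `|x - y|]].

Definition gcd_coords (d : nat) (r : 'rV[int]_d) (s : nat) : nat :=
  gcdn (\big[gcdn/0%N]_(j < d) absz (r 0 j)) s.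

Definition rational_vector (R : realType) (d : nat)
    (r : 'rV[int]_d) (s : nat) : 'rV[R]_d :=
  \row_j ((r 0 j)%:~R / s%:R).

Definition rationals_up_to (R : realType) (d : nat)
    (C : set 'rV[R]_d) (N : nat) : set 'rV[R]_d :=
  [set x | C x /\ exists (r : 'rV[int]_d) (s : nat),
    [/\ gcd_coords r s = 1%N, (1 <= s <= N)%N & x = rational_vector R r s]].

(* Main.v *)
(* Two distinct rational vectors of height at most N differ by at least 1 / N^2
   in some coordinate, whereas C is covered by J^n pieces of diameter at most
   tau^n diam. If tau^n diam N^2 < 1, each piece contains at most one rational
   vector of height at most N, so there are at most J^n of them. For the least
   such n: either n = 0, and the count is at most 1, or
   tau^(n-1) diam N^2 >= 1, and raising this to the power D, with tau^D = 1/J,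
   gives J^(n-1) <= (diam N^2)^D. *)

Require Import Defs.
From mathcomp Require Import all_boot all_order all_algebra.
From mathcomp Require Import finmap.
From mathcomp Require Import all_classical all_reals all_analysis.
From mathcomp Require Import ring.
Set Implicit Arguments.
Unset Strict Implicit.
Unset Printing Implicit Defensive.
Import Order.TTheory GRing.Theory Num.Theory.
Import numFieldNormedType.Exports.
Local Open Scope classical_set_scope.
Local Open Scope ring_scope.

Lemma card_fset_set_inj (T : choiceType) (U : finType) (A : set T)
    (f : T -> U) :
  {in A &, injective f} -> finite_set A /\ (#|` fset_set A| <= #|U|)%N.
Proof.
move=> finj; have Afin : finite_set A.
  by rewrite -(eq_finite_set (inj_card_eq finj)); exact: finite_finset.
split=> //; rewrite -(size_map f) cardE.
apply: uniq_leq_size => [|u _]; last by rewrite mem_enum.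
rewrite map_inj_in_uniq ?fset_uniq// => x y.
by rewrite !in_fset_set//; apply: finj.
Qed.

Lemma row_coord_le_norm (R : realType) (d : nat) (x : 'rV[R]_d) (j : 'I_d) :
  `|x 0 j| <= `|x|.
Proof. by rewrite [leRHS]mx_normrE; apply: (le_bigmax _ _ (0, j)). Qed.

Lemma norm_sub_le_diam (R : realType) (d : nat) (C : set 'rV[R]_d) :
  compact C -> forall x y, C x -> C y -> `|x - y| <= diam C.
Proof.
move=> /compact_bounded[M [_ Mbound]] x y Cx Cy.
apply: ub_le_sup; last by exists x, y.
(* Boundedness bounds the norm on [C] by every real exceeding [M], hence by [M + 1]; the triangle
   inequality doubles it. *)
exists ((M + 1) + (M + 1)) => _ [u [v [Cu Cv ->]]].
by apply: le_trans (ler_normB _ _) _; apply: lerD; apply: (Mbound (M + 1));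
   rewrite ?ltrDl.
Qed.

(** In a coordinate where the vectors differ, [s * s'] times the difference is a nonzero integer,
    and [s * s' <= N ^ 2]. *)
Lemma rational_vector_gap (R : realType) (d : nat) (r r' : 'rV[int]_d)
    (s s' N : nat) :
    (1 <= s <= N)%N -> (1 <= s' <= N)%N ->
    rational_vector R r s != rational_vector R r' s' ->
  1 <= N%:R ^+ 2 * `|rational_vector R r s - rational_vector R r' s'|.
Proof.
move=> /andP[s_gt0 sN] /andP[s'_gt0 s'N] neq.
have [j neqj] : exists j,
    rational_vector R r s 0 j != rational_vector R r' s' 0 j.
  apply/existsP; apply: contraNT neq => /existsPn eqrr'.
  by apply/eqP/rowP => j; apply/eqP; move: (eqrr' j); rewrite negbK.
have s0 : (s%:R : R) != 0 by rewrite pnatr_eq0 -lt0n.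
have s'0 : (s'%:R : R) != 0 by rewrite pnatr_eq0 -lt0n.
set a := r 0 j * s'%:Z - r' 0 j * s%:Z.
have coordE : s%:R * s'%:R *
    (rational_vector R r s 0 j - rational_vector R r' s' 0 j) = a%:~R.
  by rewrite !mxE rmorphB !rmorphM /= -!pmulrn; field; rewrite s0 s'0.
have a_neq0 : a != 0.
  by rewrite -(intr_eq0 R) -coordE !mulf_neq0 // subr_eq0.
have : 1 <= `|a%:~R : R| by rewrite -intr_norm ler1z -gtz0_ge1 normr_gt0.
move/le_trans; apply; rewrite -coordE normrM ger0_norm ?mulr_ge0 ?ler0n//.
apply: ler_pM; rewrite ?mulr_ge0 ?ler0n//.
  by rewrite expr2 ler_pM ?ler0n// ler_nat.
by apply: le_trans (row_coord_le_norm _ j); rewrite !mxE.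
Qed.

(* [f] sends a point of [C] to the word of some piece [F j1 (... (F jn C))]
   that contains it. *)
Lemma attractor_code (R : realType) (d J : nat)
    (F : 'I_J -> 'rV[R]_d -> 'rV[R]_d) (C : set 'rV[R]_d) (tau : R) (n : nat) :
    0 <= tau -> (forall j x y, `|F j x - F j y| <= tau * `|x - y|) ->
    is_attractor F C ->
  exists f : 'rV[R]_d -> n.-tuple 'I_J,
    forall x y, C x -> C y -> f x = f y -> `|x - y| <= tau ^+ n * diam C.
Proof.
move=> tau_ge0 Ftau [C0 Ccompact Cfix].
have Cprev x : C x -> exists p : 'I_J * 'rV[R]_d, C p.2 /\ F p.1 p.2 = x.
  by rewrite -{1}Cfix => -[j _ [y Cy <-]]; exists (j, y).
have [x0 Cx0] := C0; have [p0 _] := Cprev _ Cx0.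
(* Choice requires a value at every point, so points outside [C] get the arbitrary [p0]. *)
have /choice[prev prevP] x : exists p : 'I_J * 'rV[R]_d,
    C x -> C p.2 /\ F p.1 p.2 = x.
  have [/Cprev[p pP]|nCx] := pselect (C x); first by exists p.
  by exists p0 => /nCx.
elim: n => [|n [f fP]].
  exists (fun=> [tuple]) => x y Cx Cy _.
  by rewrite expr0 mul1r norm_sub_le_diam.
exists (fun x => [tuple of (prev x).1 :: f (prev x).2]) => x y Cx Cy.
move=> /(congr1 val)[eq1 /val_inj eq2].
have [[Cx' Fx] [Cy' Fy]] := (prevP x Cx, prevP y Cy).
rewrite -Fx -Fy eq1; apply: le_trans (Ftau _ _ _) _.
by rewrite exprS -mulrA ler_wpM2l// fP.
Qed.

Lemma max_rate_bounds (R : realType) (J : nat) (tau_ : 'I_J -> R) :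
    (0 < J)%N -> (forall j, 0 < tau_ j < 1) -> 0 < max_rate tau_ < 1.
Proof.
case: J tau_ => // J tau_ _ tau01; apply/andP; split.
  by apply: lt_le_trans (le_bigmax _ _ ord0); case/andP: (tau01 ord0).
by apply: bigmax_lt => // j _; case/andP: (tau01 j).
Qed.

(** Both sides are the exponential of [n * ln J], because the exponent is [ln J / ln tau]. *)
Lemma expr_powR_dimension (R : realType) (tau : R) (J n : nat) :
    0 < tau < 1 -> (0 < J)%N ->
  (tau ^+ n) `^ (- (- ln (J%:R : R) / ln tau)) = J%:R ^+ n.
Proof.
move=> /andP[tau0 tau1] J_gt0.
have lntau : ln tau != 0 by rewrite lt_eqF// ln_lt0// tau0.
rewrite /powR expf_eq0 (gt_eqF tau0) andbF lnXn//.
rewrite -[RHS]lnK ?posrE ?exprn_gt0 ?ltr0n// lnXn ?ltr0n//.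
by rewrite -[ln tau *+ n]mulr_natr -[ln _ *+ n]mulr_natr; congr expR; field.
Qed.

Lemma ex_geometric_lt1 (R : realType) (tau a : R) :
  0 < tau < 1 -> exists n, a * tau ^+ n < 1.
Proof.
move=> /andP[tau0 tau1].
have /cvgrPdist_lt/(_ 1 ltr01)[n _ /(_ n (leqnn n))] :
    geometric a tau @ \oo --> 0.
  by apply: cvg_geometric; rewrite ger0_norm ?ltW.
by rewrite /= sub0r normrN => /(le_lt_trans (ler_norm _)); exists n.
Qed.

(* The maximum with 1 is needed: the bound J^2 diam^D N^(2D) is smaller than 1
   when diam * N^2 < tau^2, but the set may then still contain one point.
   For instance [0, 1/8] is the attractor of x/2 and x/2 + 1/16, with D = 1,
   and for N = 1 it contains the integer 0 whereas the bound is 1/2. *)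
Theorem theorem4p1 (R : realType) (d J : nat)
    (F : 'I_J -> 'rV[R]_d -> 'rV[R]_d) (tau_ : 'I_J -> R)
    (C : set 'rV[R]_d)
    (hF : forall j : 'I_J, contraction_rate (F j) (tau_ j))
    (hC : is_attractor F C) (N : nat) :
  let tau := max_rate tau_ in
  let D := - ln (J%:R : R) / ln tau in
  finite_set (rationals_up_to C N) /\
  (#|` fset_set (rationals_up_to C N)|%:R : R) <=
    Num.max 1 (J%:R ^+ 2 * diam C `^ D * N%:R `^ (2 * D)).
Proof.
move=> tau D; set S := rationals_up_to C N.
have J_gt0 : (0 < J)%N.
  have [[x Cx] _ Cfix] := hC; move: Cx; rewrite -Cfix => -[j _ _].
  exact: leq_ltn_trans (leq0n j) (ltn_ord j).
have tau01 : 0 < tau < 1.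
  by apply: max_rate_bounds => // j; case: (hF j) => -> ->.
have /andP[tau_gt0 tau_lt1] := tau01.
have Ftau j x y : `|F j x - F j y| <= tau * `|x - y|.
  have [_ _ lipF] := hF j; apply: (le_trans (lipF (x, y) _)) => //=.
  by rewrite ler_wpM2r// le_bigmax.
have card_le n : (N%:R ^+ 2 * diam C) * tau ^+ n < 1 ->
    finite_set S /\ (#|` fset_set S| <= J ^ n)%N.
  have [f fP] := attractor_code n (ltW tau_gt0) Ftau hC.
  move=> small; rewrite -[J in (J ^ n)%N]card_ord -card_tuple.
  apply: (card_fset_set_inj (f := f)) => x y /set_mem[Cx [r [s [_ sN xE]]]].
  move=> /set_mem[Cy [r' [s' [_ s'N yE]]]] fxy; apply/eqP/negP => /negP neq.
  have := @rational_vector_gap R d r r' s s' N sN s'N.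
  rewrite -xE -yE => /(_ neq).
  rewrite leNgt => /negP; apply; apply: le_lt_trans small.
  by rewrite -mulrA (mulrC (diam C)) ler_wpM2l ?sqr_ge0 ?fP.
have ex_n := ex_geometric_lt1 (N%:R ^+ 2 * diam C) tau01.
have [n small min_n] := ex_minnP ex_n.
have [Sfin cardS] := card_le n small; split=> //.
rewrite le_max; case: n => [|n] in small min_n cardS *.
  by rewrite lern1 cardS.
apply/orP; right.
(* By minimality of [n.+1], the exponent [n] is still too small. *)
have a_ge : 1 <= (N%:R ^+ 2 * diam C) * tau ^+ n.
  by rewrite leNgt; apply/negP => /min_n; rewrite ltnn.
have diam_ge0 : 0 <= diam C.
  have [[x Cx] Ccompact _] := hC.
  by apply: le_trans (norm_sub_le_diam Ccompact Cx Cx).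
have D_ge0 : 0 <= D.
  rewrite /D mulNr -mulrN -invrN mulr_ge0 ?ln_ge0 ?ler1n// invr_ge0 oppr_ge0.
  by rewrite ln_le0// ltW.
have tauX : 0 < tau ^+ n by rewrite exprn_gt0.
have Jn_le : J%:R ^+ n <= diam C `^ D * N%:R `^ (2 * D).
  rewrite mulrC powRrM powR_mulrn ?ler0n// -powRM ?sqr_ge0//.
  (* Once [J ^ n] is written as the inverse of [(tau ^ n) ^ D], the claim is [a_ge] raised to the
     power [D >= 0]. *)
  rewrite -(expr_powR_dimension n tau01 J_gt0) -/D powRN.
  rewrite -[leLHS]mul1r ler_pdivrMr ?powR_gt0//.
  rewrite -powRM ?(ltW tauX) ?mulr_ge0 ?sqr_ge0//.
  have := ge0_ler_powR D_ge0 _ _ a_ge; rewrite powR1; apply.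
    by rewrite nnegrE.
  by rewrite nnegrE (le_trans ler01).
apply: le_trans (_ : (J ^ n.+1)%:R <= _); first by rewrite ler_nat.
(* One factor [J] pays for passing from [n] to [n.+1]; the other is bounded below by 1. *)
rewrite natrX exprS -mulrA expr2 -mulrA ler_wpM2l ?ler0n//.
by apply: le_trans Jn_le _; rewrite ler_peMl ?mulr_ge0 ?powR_ge0 ?ler1n//.
Qed.
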